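(* Every $5$-oriented Spherical Diagram has at least eight arcs; every $5$-oriented Spherical Occlusion Diagram has at least nine arcs.
   Context: A geodesic arc on the unit sphere in $\mathbb R^3$ is the unique shortest curve joining two non-antipodal points. An arc $a$ blocks an arc $b$ (equivalently, $b$ hits $a$) if an endpoint of $b$ lies in the relative interior of $a$. A Spherical Diagram (SD) is a finite non-empty collection $\mathcal D$ of pairwise interior-disjoint geodesic arcs on the unit sphere such that each arc of $\mathcal D$ is blocked by arcs of $\mathcal D$ at each of its endpoints. A Spherical Occlusion Diagram (SOD) is an SD such that all arcs of $\mathcal D$ that hit the same arc of $\mathcal D$ reach it from the same side. An SD $\mathcal D$ is $k$-oriented if there exist a set $P$ of $k$ points on the unit sphere (poles), no two antipodal, and a function $f\colon\mathcal D\to P$ such that each arc $a\in\mathcal D$ lies on a great circle through $f(a)$ but contains neither $f(a)$ nor its antipode $-f(a)$. *)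

(* Defs.v *)
From Stdlib Require Import Reals List.
Import ListNotations.
Open Scope R_scope.

Record vec : Type := mkVec { vx : R; vy : R; vz : R }.

Definition vadd (u v : vec) : vec := mkVec (vx u + vx v) (vy u + vy v) (vz u + vz v).
Definition vscale (s : R) (u : vec) : vec := mkVec (s * vx u) (s * vy u) (s * vz u).
Definition vopp (u : vec) : vec := mkVec (- vx u) (- vy u) (- vz u).
Definition vzero : vec := mkVec 0 0 0.
Definition vdot (u v : vec) : R := vx u * vx v + vy u * vy v + vz u * vz v.
Definition vcross (u v : vec) : vec :=
  mkVec (vy u * vz v - vz u * vy v) (vz u * vx v - vx u * vz v) (vx u * vy v - vy u * vx v).
Definition vdet (u v w : vec) : R := vdot (vcross u v) w.

Definition on_sphere (u : vec) : Prop := vdot u u = 1.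

Record arc : Type := mkArc { ap : vec; aq : vec }.

Definition valid_arc (a : arc) : Prop :=
  on_sphere (ap a) /\ on_sphere (aq a) /\ ap a <> aq a /\ aq a <> vopp (ap a).

(** Points of the (closed) shortest great-circle arc between non-antipodal
    p and q: the unit vectors in the cone { s p + t q | s, t >= 0 }. *)
Definition on_arc (a : arc) (x : vec) : Prop :=
  on_sphere x /\ exists s t, 0 <= s /\ 0 <= t /\ x = vadd (vscale s (ap a)) (vscale t (aq a)).

Definition in_relint (a : arc) (x : vec) : Prop :=
  on_sphere x /\ exists s t, 0 < s /\ 0 < t /\ x = vadd (vscale s (ap a)) (vscale t (aq a)).

Definition default_arc : arc := mkArc vzero vzero.

Definition blocks (a b : arc) : Prop := in_relint a (ap b) \/ in_relint a (aq b).

(** A diagram is a list of arcs; pairwise interior-disjointness for distinct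
    indices also forces the arcs of the list to be distinct, so [length D]
    is the number of arcs. *)
Definition spherical_diagram (D : list arc) : Prop :=
  D <> [] /\
  Forall valid_arc D /\
  (forall i j, (i < length D)%nat -> (j < length D)%nat -> i <> j ->
     forall x, ~ (in_relint (nth i D default_arc) x /\ in_relint (nth j D default_arc) x)) /\
  (forall b, In b D ->
     (exists a, In a D /\ in_relint a (ap b)) /\
     (exists a, In a D /\ in_relint a (aq b))).

Definition endpoint_pair (b : arc) (e f : vec) : Prop :=
  (e = ap b /\ f = aq b) \/ (e = aq b /\ f = ap b).

(** Occlusion condition: all arcs hitting the same arc a reach it from the
    same side of the great circle of a (the side is that of the other,
    free endpoint, measured by the sign of det(ap a, aq a, .)). *)
Definition spherical_occlusion_diagram (D : list arc) : Prop :=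
  spherical_diagram D /\
  forall a b c e f e' f', In a D -> In b D -> In c D ->
    endpoint_pair b e f -> in_relint a e ->
    endpoint_pair c e' f' -> in_relint a e' ->
    vdet (ap a) (aq a) f * vdet (ap a) (aq a) f' > 0.

Definition k_oriented (k : nat) (D : list arc) : Prop :=
  exists P : list vec,
    length P = k /\ Forall on_sphere P /\
    (forall i j, (i < k)%nat -> (j < k)%nat -> i <> j ->
       nth i P vzero <> nth j P vzero /\ nth i P vzero <> vopp (nth j P vzero)) /\
    exists f : nat -> nat, forall i, (i < length D)%nat ->
      (f i < k)%nat /\
      let c := nth (f i) P vzero in
      let a := nth i D default_arc in
      vdet (ap a) (aq a) c = 0 /\ ~ on_arc a c /\ ~ on_arc a (vopp c).

(* Main.v *)
Require Import Defs.
From Stdlib Require Import Reals List Lra Lia Bool Arith PArith FMapPositive.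
Import ListNotations.
Open Scope R_scope.

(** Every condition on a diagram is a condition on the signs of the determinants of triples of
    normals [normal a = vcross (ap a) (aq a)]. If the arc [a] hits [b], then the endpoint in question
    is a nonzero multiple of [vcross (normal a) (normal b)], whose sign is given by the side of [b]
    on which [a] lies, and a point of the great circle of [a] cut out by [b] precedes the one cut
    out by [c] according to the sign of [vdet (normal a) (normal b) (normal c)]. Likewise, two arcs
    that are not on one great circle can only have [c] as a common pole if [c] is a multiple of the
    cross product of their normals, which again fixes the signs of some determinants. The signs
    are related by the three-term Grassmann-Plücker relations.

    Starting from one arc, the blockers of the free endpoints are guessed one after the other, each
    being an arc met before or a new one, and signs are propagated through the relations. No closed
    diagram with at most seven arcs (eight in the one-sided case) whose arcs can be distributed over
    five poles survives. Interior-disjointness only serves to show that an arc and its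
    blocker lie on different great circles. *)

(** * Sets of signs *)

(** The abstract value of a real number: one flag for each sign that it may still have. The empty
    set stands for a contradiction. *)
Inductive signs := Signs (neg zero pos : bool).

Definition signs_neg (d : signs) := let '(Signs n z p) := d in Signs p z n.
Definition signs_meet (d e : signs) :=
  let '(Signs n z p) := d in let '(Signs n' z' p') := e in Signs (n && n') (z && z') (p && p').
Definition signs_mul (d e : signs) :=
  let '(Signs n z p) := d in let '(Signs n' z' p') := e in
  Signs (n && p' || p && n') (z || z') (p && p' || n && n').
Definition signs_add (d e : signs) :=
  let '(Signs n z p) := d in let '(Signs n' z' p') := e in
  Signs (n || n') (z && z' || n && p' || p && n') (p || p').
(** The possible signs of [y] when [x] has a sign in [d] and [x * y] one in [e]. *)
Definition signs_quot (d e : signs) :=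
  let '(Signs n z p) := d in let '(Signs n' z' p') := e in
  Signs (n && p' || p && n' || z && z') (z' && (n || z || p)) (p && p' || n && n' || z && z').
Definition signs_le (d e : signs) :=
  let '(Signs n z p) := d in let '(Signs n' z' p') := e in implb n n' && implb z z' && implb p p'.
Definition signs_empty (d : signs) := let '(Signs n z p) := d in negb (n || z || p).
Definition signs_full (d : signs) := let '(Signs n z p) := d in n && z && p.
Definition sign_only (s : bool) := Signs (negb s) false s.
Definition zero_only := Signs false true false.
Definition any_sign := Signs true true true.

(** * Search for closed diagrams *)

Definition even_permb (t : nat * nat * nat) (a b c : nat) : bool :=
  let '(x, y, z) := t in
  ((a =? x) && (b =? y) && (c =? z) || (a =? y) && (b =? z) && (c =? x)
   || (a =? z) && (b =? x) && (c =? y))%nat.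

(** A determinant alternates in its arguments, so only increasing triples need a key. Eight labels
    suffice because no diagram with more than eight arcs is searched. *)
Definition triples : list (nat * nat * nat) :=
  flat_map (fun c => flat_map (fun b => map (fun a => (a, b, c)) (seq 0 b)) (seq 0 c)) (seq 0 8).

(** [Known k s] stands for plus or minus the determinant of the [k]-th triple of labels. *)
Inductive entry := Zero | Known (k : positive) (s : bool) | Unknown.

Fixpoint find_entry (ts : list (nat * nat * nat)) (k : positive) (a b c : nat) : entry :=
  match ts with
  | [] => if ((a =? b) || (b =? c) || (a =? c))%nat then Zero else Unknown
  | t :: ts =>
      if even_permb t a b c then Known k true
      else if even_permb t b a c then Known k false
      else find_entry ts (Pos.succ k) a b c
  end.

(** Evaluated in advance, so that the search does three list lookups instead of scanning
    [triples]. *)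
Definition entries : list (list (list entry)) := Eval vm_compute in
  map (fun a => map (fun b => map (find_entry triples 1 a b) (seq 0 8)) (seq 0 8)) (seq 0 8).

Definition entry_of (a b c : nat) : entry := nth c (nth b (nth a entries []) []) Unknown.

(** The relation [x1 * x2 - y1 * y2 + z1 * z2 = 0]. *)
Record relation := Relation { x1 : entry; x2 : entry; y1 : entry; y2 : entry; z1 : entry; z2 : entry }.

Definition plucker (a b c d e : nat) : relation :=
  Relation (entry_of a b c) (entry_of a d e) (entry_of a b d) (entry_of a c e)
           (entry_of a b e) (entry_of a c d).

(** Permuting [b], [c], [d], [e] changes a relation at most by a sign, and a coincidence among the
    five labels makes it trivial. *)
Definition relations : list relation :=
  flat_map (fun e => flat_map (fun d => flat_map (fun c => flat_map (fun b => flat_map (fun a =>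
    if ((a =? b) || (a =? c) || (a =? d) || (a =? e))%nat then [] else [plucker a b c d e])
    (seq 0 8)) (seq 0 c)) (seq 0 d)) (seq 0 e)) (seq 0 8).

Definition mentions (k : positive) (r : relation) : bool :=
  existsb (fun e => match e with Known k' _ => Pos.eqb k k' | _ => false end)
    [x1 r; x2 r; y1 r; y2 r; z1 r; z2 r].

Definition index (rs : list relation) : PositiveMap.t (list relation) :=
  fold_right (fun k => PositiveMap.add k (filter (mentions k) rs)) (PositiveMap.empty _)
    (map Pos.of_nat (seq 1 (length triples))).

Definition table : PositiveMap.t (list relation) := index relations.

Definition state := PositiveMap.t signs.

Definition get (st : state) (e : entry) : signs :=
  match e with
  | Zero => zero_only
  | Known k s =>
      match PositiveMap.find k st with
      | Some d => if s then d else signs_neg d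
      | None => any_sign
      end
  | Unknown => any_sign
  end.

(** A state together with the queue of the keys whose relations are still to be propagated. *)
Definition queued := (state * list positive)%type.

Definition restrict (e : entry) (d : signs) (sq : queued) : option queued :=
  match e with
  | Zero => if signs_empty (signs_meet zero_only d) then None else Some sq
  | Unknown => Some sq
  | Known k s =>
      let '(st, q) := sq in
      let d := if s then d else signs_neg d in
      let o := get st (Known k true) in
      if signs_le o d then Some sq else
      let o' := signs_meet o d in
      if signs_empty o' then None else Some (PositiveMap.add k o' st, k :: q)
  end.

Definition bind {A B} (x : option A) (f : A -> option B) : option B :=
  match x with Some a => f a | None => None end.

Definition refine (e1 e2 : entry) (v1 v2 d : signs) (sq : queued) : option queued :=
  let v := signs_mul v1 v2 in
  if signs_le v d then Some sq else
  let v' := signs_meet v d in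
  bind (restrict e1 (signs_quot v2 v') sq) (restrict e2 (signs_quot v1 v')).

(** The relation is solved for each of its three products in turn. The signs read at the outset stay
    valid bounds while the state shrinks. Nothing can be gained when both [x] and [z] are
    unrestricted. *)
Definition step (r : relation) (sq : queued) : option queued :=
  let st := fst sq in
  let vx1 := get st (x1 r) in let vx2 := get st (x2 r) in let x := signs_mul vx1 vx2 in
  let vz1 := get st (z1 r) in let vz2 := get st (z2 r) in let z := signs_mul vz1 vz2 in
  if signs_full x && signs_full z then Some sq else
  let vy1 := get st (y1 r) in let vy2 := get st (y2 r) in let y := signs_mul vy1 vy2 in
  bind (refine (y1 r) (y2 r) vy1 vy2 (signs_add x z) sq) (fun sq =>
  bind (refine (x1 r) (x2 r) vx1 vx2 (signs_add y (signs_neg z)) sq)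
       (refine (z1 r) (z2 r) vz1 vz2 (signs_add y (signs_neg x)))).

Fixpoint steps (rs : list relation) (sq : queued) : option queued :=
  match rs with
  | [] => Some sq
  | r :: rs => bind (step r sq) (steps rs)
  end.

(** When the fuel runs out, propagation merely stops early: the state is then weaker but still
    correct. *)
Fixpoint close (fuel : nat) (tbl : PositiveMap.t (list relation)) (sq : queued) : option state :=
  match fuel, sq with
  | S fuel, (st, k :: q) =>
      match PositiveMap.find k tbl with
      | Some rs => bind (steps rs (st, q)) (close fuel tbl)
      | None => close fuel tbl (st, q)
      end
  | _, (st, _) => Some st
  end.

Definition fact := (nat * nat * nat * signs)%type.

Fixpoint restricts (fs : list fact) (sq : queued) : option queued :=
  match fs with
  | [] => Some sq
  | (a, b, c, d) :: fs => bind (restrict (entry_of a b c) d sq) (restricts fs)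
  end.

Definition assume (tbl : PositiveMap.t (list relation)) (fs : list fact) (st : state) : option state :=
  bind (restricts fs (st, [])) (close 1000 tbl).

(** [first] and [last] say which label blocks [ap] resp. [aq]; the boolean [t] beside
    a label [b] means that the point in question is a positive multiple of
    [vcross (normal a) (normal b)] if [t] holds and a negative one otherwise.
    A hitter also records the side from which it comes. *)
Record node := Node {
  first : option (nat * bool);
  last : option (nat * bool);
  hitters : list (nat * bool * bool) }.
Definition blank : node := Node None None [].

(** The sign given by [order_sign] when, along [a], the point cut out by [b] precedes the one cut
    out by [c]. *)
Definition order_fact (a b c : nat) (s t : bool) : fact := (a, b, c, sign_only (eqb s t)).

(** On [b], the hit lies between the two ends, as far as their blockers are known. On [i], it is
    itself an end, so it lies beyond the opposite end and all points where [i] is hit. As seen from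
    [b] the point carries [negb t], the cross product being antisymmetric. *)
Definition hit_facts (H : list node) (i : nat) (e : bool) (b : nat) (s : bool) : list fact :=
  let t := eqb e s in
  let ni := nth i H blank in
  let nb := nth b H blank in
  match first nb with Some (c, u) => [order_fact b c i u (negb t)] | None => [] end ++
  match last nb with Some (c, u) => [order_fact b i c (negb t) u] | None => [] end ++
  (if e then
     match first ni with Some (c, u) => [order_fact i c b u t] | None => [] end ++
     map (fun '(h, v, _) => order_fact i h b v t) (hitters ni)
   else
     match last ni with Some (c, u) => [order_fact i b c t u] | None => [] end ++
     map (fun '(h, v, _) => order_fact i b h t v) (hitters ni)).

(** One recorded hitter is enough to compare with, since the others passed the same test when they
    were added. *)
Definition side_ok (sod : bool) (H : list node) (b : nat) (s : bool) : bool :=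
  if sod then
    match hitters (nth b H blank) with
    | (_, _, s') :: _ => eqb s s'
    | [] => true
    end
  else true.

Fixpoint update (l : list node) (i : nat) (f : node -> node) : list node :=
  match l, i with
  | [], _ => []
  | x :: l, O => f x :: l
  | x :: l, S i => x :: update l i f
  end.

Definition add_hit (H : list node) (i : nat) (e : bool) (b : nat) (s : bool) : list node :=
  let t := eqb e s in
  update
    (update H i (fun x => if e then Node (first x) (Some (b, t)) (hitters x)
                          else Node (Some (b, t)) (last x) (hitters x)))
    b (fun x => Node (first x) (last x) ((i, negb t, s) :: hitters x)).

Definition candidates (H : list node) : list (nat * bool) :=
  list_prod (seq 0 (length H)) [true; false].

Definition consistent (st : state) (fs : list fact) : bool :=
  forallb (fun '(a, b, c, d) => negb (signs_empty (signs_meet d (get st (entry_of a b c))))) fs.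

(** A cost that only steers the search towards the most constrained free end; soundness does not
    depend on it. *)
Definition options (sod : bool) (st : state) (H : list node) (i : nat) (e : bool) : nat :=
  length (filter (fun '(b, s) => if side_ok sod H b s then consistent st (hit_facts H i e b s)
                                 else false) (candidates H)).

Definition free_ends (H : list node) : list (nat * bool) :=
  flat_map (fun i =>
    match first (nth i H blank) with None => [(i, false)] | _ => [] end ++
    match last (nth i H blank) with None => [(i, true)] | _ => [] end) (seq 0 (length H)).

Fixpoint cheapest (cost : nat * bool -> nat) (l : list (nat * bool)) (x : nat * bool) (c : nat) :=
  match l with
  | [] => x
  | y :: l =>
      let c' := cost y in
      if (c' <? c)%nat then cheapest cost l y c' else cheapest cost l x c
  end.

Definition pick (sod : bool) (st : state) (H : list node) : option (nat * bool) :=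
  match free_ends H with
  | [] => None
  | x :: l => Some (cheapest (fun '(i, e) => options sod st H i e) (x :: l) x 1000)
  end.

(** The signs of [common_pole_sign]: once [s] is guessed for the blocker of [ap], the sign for the
    blocker of [aq] is forced. *)
Definition pole_facts (H : list node) (i j : nat) (s : bool) : list fact :=
  match nth i H blank with
  | Node (Some (b, t)) (Some (c, u)) _ =>
      [(i, b, j, sign_only s); (i, c, j, sign_only (eqb s (eqb t u)))]
  | _ => []
  end.

Definition fails_or (r : option state) (k : state -> bool) : bool :=
  match r with Some st => k st | None => true end.

(** Arcs with a common pole either lie on one great circle, so that every determinant containing
    both normals vanishes, or satisfy [pole_facts]. *)
Fixpoint together (tbl : PositiveMap.t (list relation)) (H : list node) (i : nat) (cls : list nat)
    (k : state -> bool) (st : state) : bool :=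
  match cls with
  | [] => k st
  | j :: cls =>
      let k := together tbl H i cls k in
      fails_or (assume tbl (map (fun l => (i, j, l, zero_only)) (seq 0 (length H))) st) k &&
      forallb (fun '(s, s') => fails_or (assume tbl (pole_facts H i j s ++ pole_facts H j i s') st) k)
        (list_prod [true; false] [true; false])
  end.

(** [true] if the labels cannot be added to the classes of arcs sharing a pole
    such that at most five classes arise. *)
Fixpoint no_poles (tbl : PositiveMap.t (list relation)) (H : list node) (labels : list nat)
    (classes : list (list nat)) (st : state) {struct labels} : bool :=
  match labels with
  | [] => false
  | i :: labels =>
      (if (5 <=? length classes)%nat then true else no_poles tbl H labels ([i] :: classes) st) &&
      forallb (fun n =>
          let cls := nth n classes [] in
          together tbl H i cls
            (no_poles tbl H labels (firstn n classes ++ (i :: cls) :: skipn (S n) classes)) st)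
        (seq 0 (length classes))
  end.

Fixpoint search (fuel : nat) (tbl : PositiveMap.t (list relation)) (sod : bool) (n : nat)
    (H : list node) (st : state) : bool :=
  match fuel with
  | O => false
  | S fuel =>
    match pick sod st H with
    | None => no_poles tbl H (seq 0 (length H)) [] st
    | Some (i, e) =>
        forallb (fun '(b, s) =>
          if side_ok sod H b s then
            fails_or (assume tbl (hit_facts H i e b s) st) (search fuel tbl sod n (add_hit H i e b s))
          else true) (candidates H) &&
        (* a new blocker is oriented so that the hit comes from its positive side *)
        (if (n <=? length H)%nat then true else
           let b := length H in
           let H := H ++ [blank] in
           fails_or (assume tbl (hit_facts H i e b true) st) (search fuel tbl sod n (add_hit H i e b true)))
    end
  end.

(** Each level of the search settles one free end. Eight arcs have sixteen ends, and one more level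
    treats the poles, so fuel 20 is ample. *)
Definition refuted (sod : bool) (n : nat) : bool :=
  search 20 table sod n [blank] (PositiveMap.empty signs).

(** * Soundness of sign propagation *)

Definition sgn (x : R) : comparison :=
  if Rlt_dec x 0 then Lt else if Rlt_dec 0 x then Gt else Eq.

Definition has_sign (d : signs) (x : R) : Prop :=
  let '(Signs n z p) := d in
  match sgn x with Lt => n | Eq => z | Gt => p end = true.

Lemma sgn_spec (x : R) :
  (sgn x = Lt /\ x < 0) \/ (sgn x = Eq /\ x = 0) \/ (sgn x = Gt /\ 0 < x).
Proof.
  unfold sgn. destruct (Rlt_dec x 0); [tauto|].
  destruct (Rlt_dec 0 x); [tauto|]. right; left; split; [reflexivity|lra].
Qed.

Lemma sgn_pos (x : R) : 0 < x -> sgn x = Gt.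
Proof. destruct (sgn_spec x) as [[-> H]|[[-> H]|[-> H]]]; intros; auto; lra. Qed.

Lemma sgn_neg (x : R) : x < 0 -> sgn x = Lt.
Proof. destruct (sgn_spec x) as [[-> H]|[[-> H]|[-> H]]]; intros; auto; lra. Qed.

Lemma sgn_0 : sgn 0 = Eq.
Proof. destruct (sgn_spec 0) as [[-> H]|[[-> H]|[-> H]]]; auto; lra. Qed.

(** Exhausts the signs of the reals and the flags; [nra] discards sign patterns that no reals
    realise. *)
Ltac signs_cases :=
  unfold has_sign;
  repeat match goal with
  | d : signs |- _ => destruct d
  end; cbn;
  repeat match goal with
  | |- context [sgn ?x] =>
      let E := fresh in let L := fresh in
      destruct (sgn_spec x) as [[E L]|[[E L]|[E L]]]; rewrite E; clear E
  end;
  intros; subst; try nra;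
  repeat match goal with b : bool |- _ => destruct b end; try discriminate; reflexivity.

Lemma has_sign_opp (d : signs) (x : R) : has_sign d x -> has_sign (signs_neg d) (- x).
Proof. signs_cases. Qed.

Lemma has_sign_meet (d e : signs) (x : R) :
  has_sign d x -> has_sign e x -> has_sign (signs_meet d e) x.
Proof. signs_cases. Qed.

Lemma has_sign_mul (d e : signs) (x y : R) :
  has_sign d x -> has_sign e y -> has_sign (signs_mul d e) (x * y).
Proof. signs_cases. Qed.

Lemma has_sign_add (d e : signs) (x y : R) :
  has_sign d x -> has_sign e y -> has_sign (signs_add d e) (x + y).
Proof. signs_cases. Qed.

Lemma has_sign_quot (d e : signs) (x y : R) :
  has_sign d x -> has_sign e (x * y) -> has_sign (signs_quot d e) y.
Proof. signs_cases. Qed.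

Lemma signs_empty_sound (d : signs) (x : R) : has_sign d x -> signs_empty d = false.
Proof. signs_cases. Qed.

Lemma has_sign_any (x : R) : has_sign any_sign x.
Proof. signs_cases. Qed.

Lemma has_sign_zero : has_sign zero_only 0.
Proof. unfold has_sign; simpl; now rewrite sgn_0. Qed.

Definition sg (s : bool) : R := if s then 1 else -1.

Lemma has_sign_only (s : bool) (x : R) : 0 < sg s * x -> has_sign (sign_only s) x.
Proof.
  unfold has_sign, sg; simpl; destruct s; intros.
  - rewrite sgn_pos; [reflexivity|lra].
  - rewrite sgn_neg; [reflexivity|lra].
Qed.

Lemma sg_eqb (s t : bool) : sg (eqb s t) = sg s * sg t.
Proof. destruct s, t; unfold sg; simpl; ring. Qed.

Lemma sg_negb (s : bool) : sg (negb s) = - sg s.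
Proof. destruct s; unfold sg; simpl; ring. Qed.

(** * Determinants of normals *)

Definition normal (a : arc) : vec := vcross (ap a) (aq a).

(** The signs of these values form the chirotope of the normals. *)
Definition chi (L : nat -> arc) (a b c : nat) : R := vdet (normal (L a)) (normal (L b)) (normal (L c)).

Ltac vec_ring :=
  unfold vdet, vdot, vcross, vadd, vscale, vopp, vzero; cbn [vx vy vz ap aq]; ring.

Lemma vdet_rotate (u v w : vec) : vdet v w u = vdet u v w.
Proof. vec_ring. Qed.

Lemma vdet_swap (u v w : vec) : vdet v u w = - vdet u v w.
Proof. vec_ring. Qed.

Lemma vdet_plucker (a b c d e : vec) :
  vdet a b c * vdet a d e - vdet a b d * vdet a c e + vdet a b e * vdet a c d = 0.
Proof. vec_ring. Qed.

Definition key_value (L : nat -> arc) (k : positive) : R :=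
  let '(a, b, c) := nth (pred (Pos.to_nat k)) triples (0, 0, 0)%nat in chi L a b c.

Definition entry_is (L : nat -> arc) (e : entry) (x : R) : Prop :=
  match e with
  | Zero => x = 0
  | Known k s => x = sg s * key_value L k
  | Unknown => True
  end.

Lemma even_permb_sound (L : nat -> arc) (x y z a b c : nat) :
  even_permb (x, y, z) a b c = true -> chi L a b c = chi L x y z.
Proof.
  unfold even_permb, chi.
  rewrite !orb_true_iff, !andb_true_iff, !Nat.eqb_eq.
  intros [[[[-> ->] ->]|[[-> ->] ->]]|[[-> ->] ->]]; [reflexivity| |].
  - apply vdet_rotate.
  - symmetry; apply vdet_rotate.
Qed.

(** The key is the position in [triples] counted from 1, whence the generalisation over the prefix
    [pre] already scanned. *)
Lemma find_entry_sound (L : nat -> arc) (ts pre : list (nat * nat * nat)) (a b c : nat) :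
  triples = pre ++ ts ->
  entry_is L (find_entry ts (Pos.of_nat (S (length pre))) a b c) (chi L a b c).
Proof.
  revert pre; induction ts as [|[[x y] z] ts IH]; intros pre E; cbn [find_entry].
  - destruct (_ || _) eqn:R; [|exact I].
    rewrite !orb_true_iff, !Nat.eqb_eq in R. unfold entry_is, chi.
    destruct R as [[->| ->]| ->]; vec_ring.
  - assert (K : key_value L (Pos.of_nat (S (length pre))) = chi L x y z).
    { unfold key_value. rewrite Nat2Pos.id by discriminate. cbn [pred].
      rewrite E, nth_middle. reflexivity. }
    destruct (even_permb (x, y, z) a b c) eqn:P1; [|destruct (even_permb (x, y, z) b a c) eqn:P2].
    + unfold entry_is. rewrite K, (even_permb_sound _ _ _ _ _ _ _ P1). unfold sg; ring.
    + unfold entry_is. rewrite K, <- (even_permb_sound L _ _ _ _ _ _ P2).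
      unfold chi. rewrite vdet_swap. unfold sg; ring.
    + replace (Pos.succ (Pos.of_nat (S (length pre))))
        with (Pos.of_nat (S (length (pre ++ [(x, y, z)])))).
      * apply IH. rewrite <- app_assoc. exact E.
      * rewrite length_app, Nat.add_1_r. rewrite <- Nat2Pos.inj_succ by discriminate. reflexivity.
Qed.

Lemma nth_map_seq {A} (f : nat -> A) (n i : nat) (d : A) :
  nth i (map f (seq 0 n)) d = f i \/ nth i (map f (seq 0 n)) d = d.
Proof.
  destruct (Nat.lt_ge_cases i n) as [H|H].
  - left. rewrite (nth_indep _ d (f 0%nat)) by now rewrite length_map, length_seq.
    rewrite map_nth, seq_nth; auto.
  - right. apply nth_overflow. now rewrite length_map, length_seq.
Qed.

Lemma entry_of_sound (L : nat -> arc) (a b c : nat) : entry_is L (entry_of a b c) (chi L a b c).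
Proof.
  unfold entry_of.
  (* The precomputed table is convertible to the expression that it was computed from. A label out
     of range leads to [Unknown], of which nothing is claimed. *)
  change entries with
    (map (fun a => map (fun b => map (find_entry triples 1 a b) (seq 0 8)) (seq 0 8)) (seq 0 8)).
  destruct (nth_map_seq (fun a => map (fun b => map (find_entry triples 1 a b) (seq 0 8)) (seq 0 8))
              8 a []) as [-> | ->]; [|now destruct b, c].
  destruct (nth_map_seq (fun b => map (find_entry triples 1 a b) (seq 0 8)) 8 b []) as [-> | ->];
    [|now destruct c].
  destruct (nth_map_seq (find_entry triples 1 a b) 8 c Unknown) as [-> | ->]; [|exact I].
  apply (find_entry_sound L triples []). reflexivity.
Qed.

(** The values are existentially quantified because an [Unknown] entry does not determine one. *)
Definition relation_holds (L : nat -> arc) (r : relation) : Prop :=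
  exists u1 u2 v1 v2 w1 w2 : R,
    entry_is L (x1 r) u1 /\ entry_is L (x2 r) u2 /\ entry_is L (y1 r) v1 /\
    entry_is L (y2 r) v2 /\ entry_is L (z1 r) w1 /\ entry_is L (z2 r) w2 /\
    u1 * u2 - v1 * v2 + w1 * w2 = 0.

Lemma relations_hold (L : nat -> arc) (r : relation) : In r relations -> relation_holds L r.
Proof.
  unfold relations. intros H.
  repeat (apply in_flat_map in H; destruct H as [? [_ H]]).
  destruct (_ || _); [contradiction|]. destruct H as [<-|[]].
  do 6 eexists. unfold plucker; cbn.
  repeat split; try apply entry_of_sound. apply vdet_plucker.
Qed.

Definition table_holds (L : nat -> arc) (tbl : PositiveMap.t (list relation)) : Prop :=
  forall k rs r, PositiveMap.find k tbl = Some rs -> In r rs -> relation_holds L r.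

Lemma index_sound (L : nat -> arc) (rs : list relation) :
  (forall r, In r rs -> relation_holds L r) -> table_holds L (index rs).
Proof.
  intros R. unfold index. generalize (map Pos.of_nat (seq 1 (length triples))).
  induction l as [|k l IH]; intros k' rs' r; cbn [fold_right].
  - rewrite PositiveMap.gempty. discriminate.
  - destruct (Pos.eq_dec k' k) as [->|N].
    + rewrite PositiveMap.gss. intros [= <-] H. apply filter_In in H. apply R, H.
    + rewrite PositiveMap.gso by assumption. apply IH.
Qed.

Lemma table_sound (L : nat -> arc) : table_holds L table.
Proof. apply index_sound, relations_hold. Qed.

Definition models (L : nat -> arc) (st : state) : Prop :=
  forall k d, PositiveMap.find k st = Some d -> has_sign d (key_value L k).

Lemma has_sign_sg (s : bool) (d : signs) (x : R) :
  has_sign d (sg s * x) -> has_sign (if s then d else signs_neg d) x.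
Proof.
  destruct s; unfold sg; intros H.
  - now rewrite Rmult_1_l in H.
  - apply has_sign_opp in H. now replace (- (-1 * x)) with x in H by ring.
Qed.

Lemma get_sound (L : nat -> arc) (st : state) (e : entry) (x : R) :
  models L st -> entry_is L e x -> has_sign (get st e) x.
Proof.
  intros M. destruct e as [|k s|]; cbn.
  - intros ->. apply has_sign_zero.
  - intros ->. specialize (M k). destruct (PositiveMap.find k st) as [d|]; [|apply has_sign_any].
    specialize (M d eq_refl). destruct s; unfold sg.
    + now rewrite Rmult_1_l.
    + replace (-1 * key_value L k) with (- key_value L k) by ring. now apply has_sign_opp.
  - intros _. apply has_sign_any.
Qed.

(** [None] reports a contradiction, so soundness means that a state satisfied by actual arcs never
    yields it. *)
Definition succeeds {A} (P : A -> Prop) (x : option A) : Prop :=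
  exists a, x = Some a /\ P a.

Lemma succeeds_bind {A B} (P : A -> Prop) (Q : B -> Prop) (x : option A) (f : A -> option B) :
  succeeds P x -> (forall a, P a -> succeeds Q (f a)) -> succeeds Q (bind x f).
Proof. intros [a [-> H]] F. apply F, H. Qed.

Lemma restrict_sound (L : nat -> arc) (e : entry) (x : R) (d : signs) (sq : queued) :
  models L (fst sq) -> entry_is L e x -> has_sign d x ->
  succeeds (fun sq => models L (fst sq)) (restrict e d sq).
Proof.
  intros M E S. destruct e as [|k s|]; cbn [restrict].
  - cbn in E. subst x.
    rewrite (signs_empty_sound _ 0) by (apply has_sign_meet; [apply has_sign_zero|exact S]).
    now exists sq.
  - destruct sq as [st q]; cbn [fst] in M.
    cbn in E; subst x. apply has_sign_sg in S. set (d' := if s then d else signs_neg d) in *.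
    set (o := get st (Known k true)).
    assert (O : has_sign o (key_value L k)).
    { apply (get_sound L); [exact M|]. cbn. unfold sg; ring. }
    destruct (signs_le o d'); [now exists (st, q)|].
    pose proof (has_sign_meet _ _ _ O S) as OS. rewrite (signs_empty_sound _ _ OS).
    eexists; split; [reflexivity|]. intros k' d0. cbn [fst].
    destruct (Pos.eq_dec k' k) as [->|N].
    + rewrite PositiveMap.gss. now intros [= <-].
    + rewrite PositiveMap.gso by assumption. apply M.
  - now exists sq.
Qed.

Lemma refine_sound (L : nat -> arc) (e1 e2 : entry) (u1 u2 : R) (v1 v2 d : signs) (sq : queued) :
  models L (fst sq) -> entry_is L e1 u1 -> entry_is L e2 u2 ->
  has_sign v1 u1 -> has_sign v2 u2 -> has_sign d (u1 * u2) ->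
  succeeds (fun sq => models L (fst sq)) (refine e1 e2 v1 v2 d sq).
Proof.
  intros M E1 E2 S1 S2 S. unfold refine.
  destruct (signs_le _ _); [now exists sq|].
  pose proof (has_sign_meet _ _ _ (has_sign_mul _ _ _ _ S1 S2) S) as P.
  eapply succeeds_bind.
  - eapply restrict_sound; [exact M|exact E1|].
    apply has_sign_quot with (x := u2); [exact S2|]. now rewrite Rmult_comm.
  - intros sq' M'. eapply restrict_sound; [exact M'|exact E2|].
    now apply has_sign_quot with (x := u1).
Qed.

Lemma step_sound (L : nat -> arc) (r : relation) (sq : queued) :
  relation_holds L r -> models L (fst sq) ->
  succeeds (fun sq => models L (fst sq)) (step r sq).
Proof.
  intros (u1 & u2 & v1 & v2 & w1 & w2 & U1 & U2 & V1 & V2 & W1 & W2 & E) M.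
  unfold step.
  pose proof (get_sound L _ _ _ M U1) as SU1. pose proof (get_sound L _ _ _ M U2) as SU2.
  pose proof (get_sound L _ _ _ M V1) as SV1. pose proof (get_sound L _ _ _ M V2) as SV2.
  pose proof (get_sound L _ _ _ M W1) as SW1. pose proof (get_sound L _ _ _ M W2) as SW2.
  pose proof (has_sign_mul _ _ _ _ SU1 SU2) as SU.
  pose proof (has_sign_mul _ _ _ _ SV1 SV2) as SV.
  pose proof (has_sign_mul _ _ _ _ SW1 SW2) as SW.
  destruct (_ && _); [now exists sq|].
  eapply succeeds_bind; [|intros sq1 M1; eapply succeeds_bind; [|intros sq2 M2]].
  - eapply refine_sound; eauto.
    replace (v1 * v2) with (u1 * u2 + w1 * w2) by lra. now apply has_sign_add.
  - cbn beta in M1. eapply refine_sound; eauto.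
    replace (u1 * u2) with (v1 * v2 + - (w1 * w2)) by lra.
    apply has_sign_add, has_sign_opp; assumption.
  - cbn beta in M2. eapply refine_sound; eauto.
    replace (w1 * w2) with (v1 * v2 + - (u1 * u2)) by lra.
    apply has_sign_add, has_sign_opp; assumption.
Qed.

Lemma steps_sound (L : nat -> arc) (rs : list relation) (sq : queued) :
  (forall r, In r rs -> relation_holds L r) -> models L (fst sq) ->
  succeeds (fun sq => models L (fst sq)) (steps rs sq).
Proof.
  revert sq; induction rs as [|r rs IH]; intros sq H M; cbn [steps].
  - now exists sq.
  - eapply succeeds_bind.
    + apply step_sound; [apply H; now left|exact M].
    + intros sq' M'. apply IH; [|exact M']. intros; apply H; now right.
Qed.

Lemma close_sound (L : nat -> arc) (tbl : PositiveMap.t (list relation)) (fuel : nat) (sq : queued) :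
  table_holds L tbl -> models L (fst sq) -> succeeds (models L) (close fuel tbl sq).
Proof.
  intros T. revert sq; induction fuel as [|fuel IH]; intros [st [|k q]] M; cbn [close];
    try now exists st.
  destruct (PositiveMap.find k tbl) as [rs|] eqn:E; [|now apply IH].
  eapply succeeds_bind.
  - apply steps_sound; [|exact M]. intros r. now apply (T k).
  - intros sq' M'. now apply IH.
Qed.

Definition fact_holds (L : nat -> arc) (f : fact) : Prop :=
  let '(a, b, c, d) := f in has_sign d (chi L a b c).

Lemma assume_sound (L : nat -> arc) (tbl : PositiveMap.t (list relation)) (fs : list fact) (st : state) :
  table_holds L tbl -> (forall f, In f fs -> fact_holds L f) -> models L st ->
  succeeds (models L) (assume tbl fs st).
Proof.
  intros T F M. unfold assume.
  apply (succeeds_bind (fun sq => models L (fst sq))).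
  - assert (M' : models L (fst (st, @nil positive))) by exact M.
    revert M'. generalize (st, @nil positive).
    induction fs as [|[[[a b] c] d] fs IH]; intros sq M'; cbn [restricts].
    + now exists sq.
    + eapply succeeds_bind.
      * eapply restrict_sound; [exact M'|apply entry_of_sound|]. apply (F (a, b, c, d)). now left.
      * intros sq'. apply IH. intros; apply F; now right.
  - intros sq'. now apply close_sound.
Qed.

(** * Arcs and their normals *)

Lemma vec_eq (u v : vec) : vx u = vx v -> vy u = vy v -> vz u = vz v -> u = v.
Proof. destruct u, v; cbn; now intros -> -> ->. Qed.

Ltac vec_eq_ring :=
  apply vec_eq; unfold vdet, vdot, vcross, vadd, vscale, vopp, vzero; cbn [vx vy vz ap aq]; ring.

Lemma vdot_self_nonneg (u : vec) : 0 <= vdot u u.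
Proof. unfold vdot. nra. Qed.

Lemma vdot_self_eq0 (u : vec) : vdot u u = 0 -> u = vzero.
Proof. unfold vdot. intros H. apply vec_eq; cbn; nra. Qed.

Lemma vcross_vcross (p q n : vec) :
  vcross (vcross p q) n = vadd (vscale (vdot p n) q) (vscale (- vdot q n) p).
Proof. vec_eq_ring. Qed.

(** Reversal negates the normal. The search uses this freedom to have a new blocker hit from its
    positive side. *)
Definition rev (a : arc) : arc := mkArc (aq a) (ap a).

Definition tip (a : arc) (e : bool) : vec := if e then aq a else ap a.

(** Measured at the end of [a] opposite to the hitting end [e], as in the occlusion condition. *)
Definition side (b a : arc) (e : bool) : R := vdet (ap b) (aq b) (tip a (negb e)).

Lemma rev_rev (a : arc) : rev (rev a) = a.
Proof. now destruct a. Qed.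

Lemma tip_rev (a : arc) (e : bool) : tip (rev a) e = tip a (negb e).
Proof. now destruct e. Qed.

Lemma side_rev_l (b a : arc) (e : bool) : side (rev b) a e = - side b a e.
Proof. unfold side. cbn. apply vdet_swap. Qed.

Lemma side_rev_r (b a : arc) (e : bool) : side b (rev a) e = side b a (negb e).
Proof. unfold side. now rewrite tip_rev. Qed.

Lemma in_relint_rev (a : arc) (x : vec) : in_relint a x -> in_relint (rev a) x.
Proof.
  intros [S (s & t & Hs & Ht & ->)]. split; [exact S|].
  exists t, s. repeat split; trivial. unfold rev. vec_eq_ring.
Qed.

Lemma valid_arc_rev (a : arc) : valid_arc a -> valid_arc (rev a).
Proof.
  intros (P & Q & N & A). repeat split; trivial; cbn.
  - congruence.
  - intros E. apply A. rewrite E. vec_eq_ring.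
Qed.

(** By Lagrange's identity the squared length of the normal is [(1 - p.q)(1 + p.q)], and a vanishing
    factor would make the endpoints equal or antipodal. *)
Lemma normal_pos (a : arc) : valid_arc a -> 0 < vdot (normal a) (normal a).
Proof.
  intros (P & Q & N & A). unfold normal, on_sphere in *.
  set (p := ap a) in *. set (q := aq a) in *.
  assert (E : vdot (vcross p q) (vcross p q) = (1 - vdot p q) * (1 + vdot p q)).
  { transitivity (vdot p p * vdot q q - vdot p q * vdot p q); [vec_ring|]. rewrite P, Q. ring. }
  destruct (vdot_self_nonneg (vcross p q)) as [H|H]; [exact H|exfalso].
  rewrite E in H. symmetry in H. apply Rmult_integral in H as [H|H].
  - apply N. assert (Z : vadd p (vscale (-1) q) = vzero).
    { apply vdot_self_eq0.
      transitivity (vdot p p + vdot q q - 2 * vdot p q); [vec_ring|]. lra. }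
    injection Z as X Y W. apply vec_eq; lra.
  - apply A. assert (Z : vadd p q = vzero).
    { apply vdot_self_eq0.
      transitivity (vdot p p + vdot q q + 2 * vdot p q); [vec_ring|]. lra. }
    injection Z as X Y W. apply vec_eq; cbn; lra.
Qed.

(** Cramer's rule in the basis formed by the endpoints and the normal, where the coordinate along
    the normal vanishes. *)
Lemma plane_coordinates (a : arc) (c : vec) :
  valid_arc a -> vdet (ap a) (aq a) c = 0 ->
  exists s t, c = vadd (vscale s (ap a)) (vscale t (aq a)).
Proof.
  intros V H. apply normal_pos in V. unfold normal in V.
  set (n := vcross (ap a) (aq a)) in *.
  exists (vdot n (vcross c (aq a)) / vdot n n), (vdot n (vcross (ap a) c) / vdot n n).
  assert (E : vscale (vdot n n) c = vadd (vscale (vdot n (vcross c (aq a))) (ap a))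
                                         (vscale (vdot n (vcross (ap a) c)) (aq a))).
  { transitivity (vadd (vadd (vscale (vdot n (vcross c (aq a))) (ap a))
                             (vscale (vdot n (vcross (ap a) c)) (aq a)))
                       (vscale (vdet (ap a) (aq a) c) n)).
    - unfold n; vec_eq_ring.
    - rewrite H; vec_eq_ring. }
  set (s := vdot n (vcross c (aq a))) in *. set (t := vdot n (vcross (ap a) c)) in *.
  set (r := vdot n n) in *. injection E as X Y Z.
  apply vec_eq; cbn; apply (Rmult_eq_reg_l r); try lra.
  - rewrite X. field. lra.
  - rewrite Y. field. lra.
  - rewrite Z. field. lra.
Qed.

(** Positivity of [vdot (normal a) (vcross v w)] expresses that [v] precedes [w] in the direction of
    [a], by less than half a turn. *)
Lemma relint_after_ap (a : arc) (x : vec) :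
  valid_arc a -> in_relint a x -> 0 < vdot (normal a) (vcross (ap a) x).
Proof.
  intros V [_ (s & t & Hs & Ht & ->)]. apply normal_pos in V.
  replace (vdot _ _) with (t * vdot (normal a) (normal a)) by (unfold normal; vec_ring).
  now apply Rmult_lt_0_compat.
Qed.

Lemma relint_before_aq (a : arc) (x : vec) :
  valid_arc a -> in_relint a x -> 0 < vdot (normal a) (vcross x (aq a)).
Proof.
  intros V [_ (s & t & Hs & Ht & ->)]. apply normal_pos in V.
  replace (vdot _ _) with (s * vdot (normal a) (normal a)) by (unfold normal; vec_ring).
  now apply Rmult_lt_0_compat.
Qed.

(** Two great circles meet in an antipodal pair along the cross product of their normals; [t]
    selects one of the two, and its scale [l] does not affect signs. *)
Definition point (a : arc) (v : vec) (b : arc) (t : bool) : Prop :=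
  exists l, 0 < l /\ v = vscale (l * sg t) (vcross (normal a) (normal b)).

Lemma point_swap (a b : arc) (v : vec) (t : bool) : point a v b t -> point b v a (negb t).
Proof.
  intros (l & Hl & ->). exists l. split; [exact Hl|]. rewrite sg_negb. vec_eq_ring.
Qed.

(** The hitting end is orthogonal to [normal b], so one term in the expansion of the triple product
    vanishes. What remains is that end times [sg e] times the side of the opposite end, which
    dictates the scale. *)
Lemma hit_point (a b : arc) (e s : bool) :
  in_relint b (tip a e) -> 0 < sg s * side b a e -> point a (tip a e) b (eqb e s).
Proof.
  intros [_ (x & y & _ & _ & T)] S.
  assert (Z : vdot (tip a e) (normal b) = 0) by (rewrite T; unfold normal; vec_ring).
  assert (E : side b a e = vdot (tip a (negb e)) (normal b)) by (unfold side, normal; vec_ring).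
  rewrite E in S. set (r := vdot (tip a (negb e)) (normal b)) in *.
  assert (R0 : r <> 0) by (intros R0; rewrite R0 in S; lra).
  assert (G : sg s <> 0) by (destruct s; unfold sg; lra).
  exists (/ (sg s * r)). split; [now apply Rinv_0_lt_compat|].
  assert (C : vcross (normal a) (normal b) = vscale (sg e * r) (tip a e)).
  { unfold normal at 1. rewrite vcross_vcross. subst r. unfold tip, sg in *.
    destruct e; cbn in *; rewrite Z; vec_eq_ring. }
  rewrite C, sg_eqb.
  assert (GE : sg e * sg e = 1) by (destruct e; unfold sg; ring).
  assert (K : / (sg s * r) * (sg e * sg s) * (sg e * r) = 1).
  { transitivity (sg e * sg e); [field; split; assumption|exact GE]. }
  apply vec_eq; cbn; rewrite <- Rmult_assoc, K; ring.
Qed.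

(** The cross product of [vcross na nb] and [vcross na nc] is the determinant of the three normals
    times [na]. *)
Lemma order_sign (a b c : arc) (v w : vec) (s t : bool) :
  point a v b s -> point a w c t -> 0 < vdot (normal a) (vcross v w) ->
  0 < sg s * sg t * vdet (normal a) (normal b) (normal c).
Proof.
  intros (l & Hl & ->) (l' & Hl' & ->) O.
  set (r := vdot (normal a) (normal a)).
  assert (E : vdot (normal a) (vcross (vscale (l * sg s) (vcross (normal a) (normal b)))
                                      (vscale (l' * sg t) (vcross (normal a) (normal c))))
              = (l * l' * r) * (sg s * sg t * vdet (normal a) (normal b) (normal c)))
    by (unfold r; vec_ring).
  rewrite E in O. assert (0 <= r) by apply vdot_self_nonneg.
  assert (0 < l * l') by now apply Rmult_lt_0_compat.
  assert (0 <= l * l' * r) by (apply Rmult_le_pos; lra).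
  set (k := l * l' * r) in *. set (x := sg s * sg t * _) in *. nra.
Qed.

(** * Poles of arcs *)

Definition pole (a : arc) (c : vec) : Prop :=
  on_sphere c /\ vdet (ap a) (aq a) c = 0 /\ ~ on_arc a c /\ ~ on_arc a (vopp c).

Lemma on_arc_rev (a : arc) (x : vec) : on_arc (rev a) x -> on_arc a x.
Proof.
  intros [S (s & t & Hs & Ht & ->)]. split; [exact S|].
  exists t, s. repeat split; trivial. unfold rev. vec_eq_ring.
Qed.

Lemma pole_rev (a : arc) (c : vec) : pole a c -> pole (rev a) c.
Proof.
  intros (S & P & A & B). repeat split; trivial.
  - cbn. rewrite vdet_swap, P. ring.
  - now intros H%on_arc_rev.
  - now intros H%on_arc_rev.
Qed.

(** Write the pole as [s p + t q]. Were [s] and [t] both nonnegative, the arc would contain the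
    pole; were they both nonpositive, it would contain the antipode. Hence [s t < 0]. *)
Lemma pole_separates (a : arc) (c : vec) :
  valid_arc a -> pole a c ->
  vdot (normal a) (vcross (ap a) c) * vdot (normal a) (vcross c (aq a)) < 0.
Proof.
  intros V (S & P & A & B).
  destruct (plane_coordinates a c V P) as (s & t & E).
  pose proof (normal_pos a V) as N. set (r := vdot (normal a) (normal a)) in *.
  replace (vdot (normal a) (vcross (ap a) c)) with (t * r) by (rewrite E; unfold r, normal; vec_ring).
  replace (vdot (normal a) (vcross c (aq a))) with (s * r) by (rewrite E; unfold r, normal; vec_ring).
  assert (ST : s * t < 0).
  { destruct (Rlt_le_dec (s * t) 0) as [H|H]; [exact H|exfalso].
    assert (C : (0 <= s /\ 0 <= t) \/ (s <= 0 /\ t <= 0)).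
    { destruct (Rtotal_order s 0) as [?|[?|?]], (Rtotal_order t 0) as [?|[?|?]];
        first [left; split; lra | right; split; lra | exfalso; nra]. }
    destruct C as [[Hs Ht]|[Hs Ht]].
    - apply A. split; [exact S|]. now exists s, t.
    - apply B. split.
      + unfold on_sphere in *. rewrite <- S. vec_ring.
      + exists (- s), (- t). repeat split; try lra. rewrite E. vec_eq_ring. }
  assert (0 < r * r) by nra. nra.
Qed.

(** A common pole is orthogonal to both normals, hence a multiple of [w]. The inequality of
    [pole_separates] is quadratic in the pole, so it passes to [w] whatever the sign of the
    multiple. *)
Lemma common_pole_separates (a b : arc) (c : vec) :
  valid_arc a -> pole a c -> vdet (ap b) (aq b) c = 0 ->
  let w := vcross (normal a) (normal b) in
  w <> vzero ->
  vdot (normal a) (vcross (ap a) w) * vdot (normal a) (vcross w (aq a)) < 0.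
Proof.
  intros V P Pb w W.
  pose proof (pole_separates a c V P) as N. destruct P as (_ & Pa & _).
  assert (E : vscale (vdot w w) c = vscale (vdot c w) w).
  { transitivity (vadd (vscale (vdot c w) w)
       (vcross w (vadd (vscale (vdet (ap b) (aq b) c) (normal a))
                       (vscale (- vdet (ap a) (aq a) c) (normal b))))).
    - unfold w, normal. vec_eq_ring.
    - rewrite Pa, Pb. vec_eq_ring. }
  set (k := vdot w w) in *. set (m := vdot c w) in *.
  assert (K : 0 < k).
  { destruct (vdot_self_nonneg w) as [H|H]; [exact H|]. now elim W; apply vdot_self_eq0. }
  assert (E1 : k * vdot (normal a) (vcross (ap a) c) = m * vdot (normal a) (vcross (ap a) w)).
  { transitivity (vdot (normal a) (vcross (ap a) (vscale k c))); [vec_ring|]. rewrite E. vec_ring. }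
  assert (E2 : k * vdot (normal a) (vcross c (aq a)) = m * vdot (normal a) (vcross w (aq a))).
  { transitivity (vdot (normal a) (vcross (vscale k c) (aq a))); [vec_ring|]. rewrite E. vec_ring. }
  set (u := vdot (normal a) (vcross (ap a) c)) in *. set (u' := vdot (normal a) (vcross c (aq a))) in *.
  set (v := vdot (normal a) (vcross (ap a) w)) in *. set (v' := vdot (normal a) (vcross w (aq a))) in *.
  assert (M : (m * m) * (v * v') < 0).
  { replace ((m * m) * (v * v')) with ((k * u) * (k * u')) by (rewrite E1, E2; ring).
    replace ((k * u) * (k * u')) with (- ((k * k) * (- (u * u')))) by ring.
    assert (0 < k * k * - (u * u')); [|lra].
    apply Rmult_lt_0_compat; [now apply Rmult_lt_0_compat|lra]. }
  nra.
Qed.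

(** Substituting the cross products for the endpoints turns [common_pole_separates] into a condition
    on the sign of [X * Y]; the witness [s] is the sign of [X]. *)
Lemma common_pole_sign (a b d d' : arc) (c : vec) (t u : bool) :
  valid_arc a -> pole a c -> vdet (ap b) (aq b) c = 0 ->
  vcross (normal a) (normal b) <> vzero ->
  point a (ap a) d t -> point a (aq a) d' u ->
  exists s, 0 < sg s * vdet (normal a) (normal d) (normal b) /\
            0 < sg (eqb s (eqb t u)) * vdet (normal a) (normal d') (normal b).
Proof.
  intros V P Pb W (l & Hl & E) (l' & Hl' & E').
  pose proof (common_pole_separates a b c V P Pb W) as N. cbn zeta in N.
  set (w := vcross (normal a) (normal b)) in *.
  set (X := vdet (normal a) (normal d) (normal b)).
  set (Y := vdet (normal a) (normal d') (normal b)).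
  set (r := vdot (normal a) (normal a)).
  assert (E1 : vdot (normal a) (vcross (ap a) w) = l * r * (sg t * X)).
  { rewrite E. unfold w, X, r. vec_ring. }
  assert (E2 : vdot (normal a) (vcross w (aq a)) = - (l' * r * (sg u * Y))).
  { rewrite E'. unfold w, Y, r. vec_ring. }
  rewrite E1, E2 in N.
  assert (R0 : 0 <= r) by apply vdot_self_nonneg.
  assert (K : 0 <= l * r * (l' * r)) by (repeat apply Rmult_le_pos; lra).
  assert (XY : 0 < sg t * sg u * (X * Y)).
  { set (k := l * r * (l' * r)) in *.
    replace (l * r * (sg t * X) * - (l' * r * (sg u * Y))) with (- (k * (sg t * sg u * (X * Y)))) in N
      by (unfold k; ring). nra. }
  destruct (Rtotal_order X 0) as [H|[H|H]].
  - exists false. rewrite !sg_eqb. destruct t, u; unfold sg in *; split; nra.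
  - rewrite H in XY. lra.
  - exists true. rewrite !sg_eqb. destruct t, u; unfold sg in *; split; nra.
Qed.

(** * Soundness of the search *)

Definition oriented (D : list arc) (a : arc) : Prop := In a D \/ In (rev a) D.

(** All that the search needs to know of a diagram, stated for arcs in either orientation. *)
Record diagram (sod : bool) (D : list arc) (P : list vec) : Prop := {
  oriented_valid : forall a, oriented D a -> valid_arc a;
  oriented_blocked : forall a e, oriented D a -> exists b, In b D /\ in_relint b (tip a e);
  oriented_transversal : forall a b e,
    oriented D a -> oriented D b -> in_relint b (tip a e) -> side b a e <> 0;
  oriented_one_sided : sod = true -> forall a b c e e',
    oriented D a -> oriented D b -> oriented D c ->
    in_relint a (tip b e) -> in_relint a (tip c e') -> 0 < side a b e * side a c e';
  oriented_pole : forall a, oriented D a -> exists c, In c P /\ pole a c;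
  five_poles : length P = 5%nat }.

(** [C] holds the labelled arcs as they occur in [D]. Its distinctness bounds the number of labels
    by the length of [D]. *)
Definition labelling (D : list arc) (L : nat -> arc) (m : nat) : Prop :=
  exists C, NoDup C /\ incl C D /\ length C = m /\
    forall i, (i < m)%nat -> L i = nth i C default_arc \/ L i = rev (nth i C default_arc).

Lemma labelling_oriented (D : list arc) (L : nat -> arc) (m i : nat) :
  labelling D L m -> (i < m)%nat -> oriented D (L i).
Proof.
  intros (C & _ & CD & <- & H) I. pose proof (CD _ (nth_In C default_arc I)) as K.
  destruct (H i I) as [-> | ->]; [now left|right; now rewrite rev_rev].
Qed.

Definition node_holds (L : nat -> arc) (m i : nat) (x : node) : Prop :=
  (forall b t, first x = Some (b, t) -> (b < m)%nat /\ point (L i) (ap (L i)) (L b) t) /\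
  (forall b t, last x = Some (b, t) -> (b < m)%nat /\ point (L i) (aq (L i)) (L b) t) /\
  (forall h t s, In (h, t, s) (hitters x) -> (h < m)%nat /\ exists e,
     in_relint (L i) (tip (L h) e) /\ point (L i) (tip (L h) e) (L h) t /\
     0 < sg s * side (L i) (L h) e).

Definition graph_holds (L : nat -> arc) (H : list node) : Prop :=
  forall i, (i < length H)%nat -> node_holds L (length H) i (nth i H blank).

Definition agree (m : nat) (L L' : nat -> arc) : Prop := forall i, (i < m)%nat -> L i = L' i.

Lemma node_holds_agree (L L' : nat -> arc) (m n i : nat) (x : node) :
  agree m L L' -> (i < m)%nat -> (m <= n)%nat -> node_holds L m i x -> node_holds L' n i x.
Proof.
  intros A I N (F & T & S). rewrite (A i I) in *. repeat split.
  - apply F in H. lia.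
  - apply F in H as [B H]. now rewrite (A b B) in H.
  - apply T in H. lia.
  - apply T in H as [B H]. now rewrite (A b B) in H.
  - apply S in H. lia.
  - apply S in H as [B H]. now rewrite (A h B) in H.
Qed.

Lemma graph_holds_agree (L L' : nat -> arc) (H : list node) :
  agree (length H) L L' -> graph_holds L H -> graph_holds L' H.
Proof. intros A G i I. eapply node_holds_agree; eauto. Qed.

Lemma graph_holds_blank (L : nat -> arc) (H : list node) :
  graph_holds L H -> graph_holds L (H ++ [blank]).
Proof.
  intros G i I. rewrite length_app in *. cbn in *.
  destruct (Nat.lt_ge_cases i (length H)) as [J|J].
  - rewrite app_nth1 by exact J. apply node_holds_agree with (L := L) (m := length H); auto.
    + now intros ? ?.
    + lia.
  - replace (nth i (H ++ [blank]) blank) with blank.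
    + repeat split; try discriminate; contradiction.
    + rewrite app_nth2 by exact J. now destruct (i - length H)%nat as [|[|?]].
Qed.

Lemma length_update (l : list node) (i : nat) (f : node -> node) : length (update l i f) = length l.
Proof. revert i; induction l as [|x l IH]; intros [|i]; cbn; auto. Qed.

Lemma nth_update (l : list node) (i j : nat) (f : node -> node) :
  (j < length l)%nat ->
  nth j (update l i f) blank = if (i =? j)%nat then f (nth j l blank) else nth j l blank.
Proof.
  revert i j; induction l as [|x l IH]; intros [|i] [|j] J; cbn in *; try lia; auto.
  apply IH. lia.
Qed.

Lemma length_add_hit (H : list node) (i : nat) (e : bool) (b : nat) (s : bool) :
  length (add_hit H i e b s) = length H.
Proof. unfold add_hit. now rewrite !length_update. Qed.

Definition hits (L : nat -> arc) (i : nat) (e : bool) (b : nat) (s : bool) : Prop :=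
  in_relint (L b) (tip (L i) e) /\ 0 < sg s * side (L b) (L i) e.

Lemma graph_holds_add_hit (L : nat -> arc) (H : list node) (i : nat) (e : bool) (b : nat) (s : bool) :
  (i < length H)%nat -> (b < length H)%nat -> hits L i e b s ->
  graph_holds L H -> graph_holds L (add_hit H i e b s).
Proof.
  intros I B [R S] G j J. rewrite length_add_hit in *.
  pose proof (hit_point _ _ _ _ R S) as P1. pose proof (point_swap _ _ _ _ P1) as P2.
  unfold add_hit. rewrite nth_update by now rewrite length_update.
  rewrite nth_update by exact J.
  set (x := nth j H blank).
  assert (Gx : node_holds L (length H) j x) by now apply G.
  set (x' := if (i =? j)%nat then _ else x).
  assert (Gx' : node_holds L (length H) j x').
  { subst x'. destruct (Nat.eqb_spec i j) as [<-|_]; [|exact Gx].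
    destruct Gx as (F & T & K).
    destruct e; split; [|split| |split]; cbn [first last hitters]; auto;
      intros b' t' [= <- <-]; split; assumption. }
  destruct (Nat.eqb_spec b j) as [<-|_]; [|exact Gx'].
  destruct Gx' as (F & T & K). split; [exact F|split; [exact T|]].
  intros h t s' [[= <- <- <-]|Q]; [|now apply K].
  split; [exact I|]. exists e. split; [exact R|split; assumption].
Qed.

Lemma order_fact_holds (L : nat -> arc) (a b c : nat) (v w : vec) (s t : bool) :
  point (L a) v (L b) s -> point (L a) w (L c) t -> 0 < vdot (normal (L a)) (vcross v w) ->
  fact_holds L (order_fact a b c s t).
Proof.
  intros V W O. apply has_sign_only. rewrite sg_eqb. eapply order_sign; eauto.
Qed.

Lemma hit_facts_hold (L : nat -> arc) (H : list node) (i : nat) (e : bool) (b : nat) (s : bool) (f : fact) :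
  (i < length H)%nat -> (b < length H)%nat -> valid_arc (L i) -> valid_arc (L b) ->
  hits L i e b s -> graph_holds L H -> In f (hit_facts H i e b s) -> fact_holds L f.
Proof.
  intros I B Vi Vb [R S] G F.
  pose proof (hit_point _ _ _ _ R S) as P1. pose proof (point_swap _ _ _ _ P1) as P2.
  destruct (G i I) as (Fi & Li & Hi). destruct (G b B) as (Fb & Lb & _).
  unfold hit_facts in F. cbn zeta in F.
  set (ni := nth i H blank) in *. set (nb := nth b H blank) in *.
  apply in_app_or in F as [F|F]; [|apply in_app_or in F as [F|F]].
  - destruct (first nb) as [[c u]|] eqn:E; [|contradiction]. destruct F as [<-|[]].
    destruct (Fb c u eq_refl) as [_ Q]. eapply order_fact_holds; eauto using relint_after_ap.
  - destruct (last nb) as [[c u]|] eqn:E; [|contradiction]. destruct F as [<-|[]].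
    destruct (Lb c u eq_refl) as [_ Q]. eapply order_fact_holds; eauto using relint_before_aq.
  - destruct e; apply in_app_or in F as [F|F].
    + destruct (first ni) as [[c u]|] eqn:E; [|contradiction]. destruct F as [<-|[]].
      destruct (Fi c u eq_refl) as [_ Q]. eapply order_fact_holds; eauto using normal_pos.
    + apply in_map_iff in F as [[[h v] s'] [<- F]]. destruct (Hi h v s' F) as (_ & e' & R' & Q & _).
      eapply order_fact_holds; eauto using relint_before_aq.
    + destruct (last ni) as [[c u]|] eqn:E; [|contradiction]. destruct F as [<-|[]].
      destruct (Li c u eq_refl) as [_ Q]. eapply order_fact_holds; eauto using normal_pos.
    + apply in_map_iff in F as [[[h v] s'] [<- F]]. destruct (Hi h v s' F) as (_ & e' & R' & Q & _).
      eapply order_fact_holds; eauto using relint_after_ap.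
Qed.

Lemma fails_or_succeeds (P : state -> Prop) (r : option state) (k : state -> bool) :
  fails_or r k = true -> succeeds P r -> exists st, P st /\ k st = true.
Proof. intros K (st & -> & H). now exists st. Qed.

Lemma pole_facts_hold (L : nat -> arc) (H : list node) (i j : nat) (c : vec) :
  (i < length H)%nat -> graph_holds L H -> valid_arc (L i) -> pole (L i) c -> pole (L j) c ->
  vcross (normal (L i)) (normal (L j)) <> vzero ->
  exists s, forall f, In f (pole_facts H i j s) -> fact_holds L f.
Proof.
  intros I G V Pi (_ & Pj & _) W. destruct (G i I) as (F & T & _).
  unfold pole_facts. destruct (nth i H blank) as [[[b t]|] [[d u]|] hs]; cbn [first last] in *;
    try (now exists true).
  destruct (F b t eq_refl) as [_ Fp]. destruct (T d u eq_refl) as [_ Tp].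
  destruct (common_pole_sign _ _ _ _ _ _ _ V Pi Pj W Fp Tp) as (s & S1 & S2).
  exists s. intros f [<-|[<-|[]]]; now apply has_sign_only.
Qed.

Lemma together_sound (L : nat -> arc) (tbl : PositiveMap.t (list relation)) (H : list node)
    (i : nat) (c : vec) (cls : list nat) (k : state -> bool) (st : state) :
  table_holds L tbl -> graph_holds L H -> (forall j, (j < length H)%nat -> valid_arc (L j)) ->
  (i < length H)%nat -> pole (L i) c ->
  (forall j, In j cls -> (j < length H)%nat /\ pole (L j) c) ->
  models L st -> together tbl H i cls k st = true ->
  exists st', models L st' /\ k st' = true.
Proof.
  intros T G V I P. revert k st; induction cls as [|j cls IH]; intros k st C M E; cbn [together] in E.
  - now exists st.
  - destruct (C j (or_introl eq_refl)) as [J Pj].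
    assert (C' : forall j, In j cls -> (j < length H)%nat /\ pole (L j) c) by (intros; apply C; now right).
    apply andb_true_iff in E as [E1 E2].
    destruct (Req_dec_T (vdot (vcross (normal (L i)) (normal (L j)))
                           (vcross (normal (L i)) (normal (L j)))) 0) as [Z|Z].
    + apply vdot_self_eq0 in Z.
      destruct (fails_or_succeeds (models L) _ _ E1) as (st' & M' & K); [|now apply IH in K].
      apply assume_sound; auto. intros f F. apply in_map_iff in F as (l & <- & _).
      unfold fact_holds, chi, vdet. rewrite Z.
      replace (vdot vzero _) with 0 by vec_ring. apply has_sign_zero.
    + assert (W : vcross (normal (L i)) (normal (L j)) <> vzero)
        by (intros W; apply Z; rewrite W; vec_ring).
      assert (W' : vcross (normal (L j)) (normal (L i)) <> vzero).
      { intros W'. apply W.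
        transitivity (vscale (-1) (vcross (normal (L j)) (normal (L i)))); [vec_eq_ring|].
        rewrite W'. vec_eq_ring. }
      destruct (pole_facts_hold L H i j c I G (V i I) P Pj W) as (s & S).
      destruct (pole_facts_hold L H j i c J G (V j J) Pj P W') as (s' & S').
      rewrite forallb_forall in E2. specialize (E2 (s, s')). cbn beta iota in E2.
      destruct (fails_or_succeeds (models L) _ _ (E2 ltac:(destruct s, s'; cbn; tauto)))
        as (st' & M' & K); [|now apply IH in K].
      apply assume_sound; auto. intros f F. apply in_app_or in F as [F|F]; auto.
Qed.

Lemma vec_eq_dec (u v : vec) : {u = v} + {u <> v}.
Proof. decide equality; apply Req_dec_T. Qed.

Lemma arc_eq_dec (a b : arc) : {a = b} + {a <> b}.
Proof. decide equality; apply vec_eq_dec. Qed.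

(** [cs] pairs each class with an actual pole of its arcs. An arc whose pole is in [cs] joins the
    matching class; otherwise it opens a new one, which is possible because distinct members of [P]
    number at most five. *)
Lemma no_poles_sound (L : nat -> arc) (tbl : PositiveMap.t (list relation)) (H : list node)
    (P : list vec) (labels : list nat) (classes : list (list nat)) (cs : list vec) (st : state) :
  table_holds L tbl -> graph_holds L H -> (forall j, (j < length H)%nat -> valid_arc (L j)) ->
  length P = 5%nat -> (forall j, (j < length H)%nat -> exists c, In c P /\ pole (L j) c) ->
  (forall j, In j labels -> (j < length H)%nat) ->
  Forall2 (fun cls c => forall j, In j cls -> (j < length H)%nat /\ pole (L j) c) classes cs ->
  NoDup cs -> incl cs P -> models L st -> no_poles tbl H labels classes st = true -> False.
Proof.
  intros T G V P5 Q. revert classes cs st.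
  induction labels as [|i labels IH]; intros classes cs st B F N I M E; cbn [no_poles] in E.
  - discriminate.
  - assert (Hi : (i < length H)%nat) by (apply B; now left).
    assert (B' : forall j, In j labels -> (j < length H)%nat) by (intros; apply B; now right).
    destruct (Q i Hi) as (c & Pc & Pi). apply andb_true_iff in E as [E1 E2].
    destruct (in_dec vec_eq_dec c cs) as [C|C].
    + apply in_split in C as (c1 & c2 & ->).
      apply Forall2_app_inv_r in F as (k1 & k' & F1 & F' & ->).
      inversion F' as [|cls ? k2 ? Fc F2]; subst.
      rewrite forallb_forall in E2. specialize (E2 (length k1)).
      rewrite nth_middle, firstn_app, firstn_all, Nat.sub_diag in E2. cbn [firstn] in E2.
      rewrite app_nil_r, skipn_app, skipn_all2, Nat.sub_succ_l, Nat.sub_diag in E2 by lia.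
      cbn [skipn app] in E2.
      destruct (together_sound L tbl H i c cls _ st T G V Hi Pi Fc M (E2 ltac:(
        apply in_seq; rewrite length_app; cbn; lia))) as (st' & M' & K).
      refine (IH _ _ st' B' _ N I M' K).
      apply Forall2_app; [exact F1|]. constructor; [|exact F2].
      intros j [<-|J]; auto.
    + apply Forall2_length in F as LF.
      assert (K : (length (c :: cs) <= length P)%nat).
      { apply NoDup_incl_length; [now constructor|]. intros x [<-|X]; auto. }
      cbn in K. destruct (Nat.leb_spec 5 (length classes)); [lia|].
      refine (IH _ (c :: cs) st B' _ _ _ M E1).
      * constructor; [|exact F]. now intros j [<-|[]].
      * now constructor.
      * intros x [<-|X]; auto.
Qed.

Lemma cheapest_in (cost : nat * bool -> nat) (l : list (nat * bool)) (x : nat * bool) (c : nat) :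
  cheapest cost l x c = x \/ In (cheapest cost l x c) l.
Proof.
  revert x c; induction l as [|y l IH]; intros x c; cbn [cheapest]; [now left|].
  cbn zeta. destruct (_ <? _)%nat.
  - destruct (IH y (cost y)) as [-> | ?]; right; [now left|now right].
  - destruct (IH x c) as [-> | ?]; [now left|right; now right].
Qed.

Lemma pick_lt (sod : bool) (st : state) (H : list node) (i : nat) (e : bool) :
  pick sod st H = Some (i, e) -> (i < length H)%nat.
Proof.
  unfold pick. destruct (free_ends H) as [|x l] eqn:E; [discriminate|].
  intros Q. assert (K : In (i, e) (free_ends H)).
  { assert (S : forall y z : nat * bool, Some y = Some z -> z = y) by congruence.
    apply S in Q. rewrite E, Q.
    destruct (cheapest_in (fun '(i, e) => options sod st H i e) (x :: l) x 1000) as [K|K].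
    - rewrite K. now left.
    - exact K. }
  unfold free_ends in K. apply in_flat_map in K as (j & J & K). apply in_seq in J.
  replace i with j; [lia|].
  apply in_app_or in K as [K|K]; destruct (_ (nth j H blank)); try contradiction;
    destruct K as [[= -> _]|[]]; reflexivity.
Qed.

Lemma sign_of (x : R) : x <> 0 -> exists s, 0 < sg s * x.
Proof.
  intros N. destruct (Rtotal_order x 0) as [H|[H|H]]; [exists false|contradiction|exists true];
    unfold sg; lra.
Qed.

Lemma side_ok_complete (sod : bool) (D : list arc) (P : list vec) (L : nat -> arc) (H : list node)
    (i : nat) (e : bool) (b : nat) (s : bool) :
  diagram sod D P -> labelling D L (length H) -> graph_holds L H ->
  (i < length H)%nat -> (b < length H)%nat -> hits L i e b s -> side_ok sod H b s = true.
Proof.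
  intros DP LD G I B [R S]. unfold side_ok. destruct sod; [|reflexivity].
  destruct (G b B) as (_ & _ & K).
  destruct (hitters (nth b H blank)) as [|[[h t] s'] hs]; [reflexivity|].
  destruct (K h t s' (or_introl eq_refl)) as (Hh & e' & R' & _ & S').
  pose proof (oriented_one_sided _ _ _ DP eq_refl (L b) (L i) (L h) e e'
    (labelling_oriented _ _ _ _ LD B) (labelling_oriented _ _ _ _ LD I)
    (labelling_oriented _ _ _ _ LD Hh) R R') as O.
  destruct s, s'; unfold sg in *; try reflexivity; nra.
Qed.

Lemma hits_agree (m : nat) (L L' : nat -> arc) (i : nat) (e : bool) (b : nat) (s : bool) :
  agree m L L' -> (i < m)%nat -> (b < m)%nat -> hits L i e b s -> hits L' i e b s.
Proof. unfold hits. intros A I B. now rewrite (A i I), (A b B). Qed.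

(* A state must be correct for every way of labelling the arcs not met so far. *)
Lemma assume_hit (tbl : PositiveMap.t (list relation)) (L : nat -> arc) (H : list node)
    (i : nat) (e : bool) (b : nat) (s : bool) (st : state) (k : state -> bool) :
  (forall L, table_holds L tbl) -> (i < length H)%nat -> (b < length H)%nat ->
  valid_arc (L i) -> valid_arc (L b) -> hits L i e b s -> graph_holds L H ->
  (forall L', agree (length H) L L' -> models L' st) ->
  fails_or (assume tbl (hit_facts H i e b s) st) k = true ->
  exists st', (forall L', agree (length H) L L' -> models L' st') /\ k st' = true.
Proof.
  intros T I B Vi Vb Hh G M E.
  assert (A : forall L', agree (length H) L L' ->
              succeeds (models L') (assume tbl (hit_facts H i e b s) st)).
  { intros L' A. apply assume_sound; auto. intros f. apply hit_facts_hold; auto.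
    - now rewrite <- (A i I).
    - now rewrite <- (A b B).
    - now apply (hits_agree (length H) L).
    - now apply (graph_holds_agree L). }
  destruct (A L) as (st' & E' & _); [now intros ? ?|].
  rewrite E' in E. exists st'. split; [|exact E].
  intros L' AL. destruct (A L' AL) as (st2 & E2 & M2).
  now replace st' with st2 by congruence.
Qed.

(** The branch that follows the actual diagram is never cut off: at each free end the true blocker
    is either labelled already or gets the next label. *)
Lemma search_sound (sod : bool) (D : list arc) (P : list vec) (n : nat)
    (tbl : PositiveMap.t (list relation)) (fuel : nat) (H : list node) (st : state) (L : nat -> arc) :
  (forall L, table_holds L tbl) -> diagram sod D P -> (length D <= n)%nat ->
  labelling D L (length H) -> graph_holds L H ->
  (forall L', agree (length H) L L' -> models L' st) ->
  search fuel tbl sod n H st = true -> False.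
Proof.
  intros T DP DN. revert H st L.
  induction fuel as [|fuel IH]; intros H st L LD G M E; [discriminate|]. cbn [search] in E.
  assert (O : forall j, (j < length H)%nat -> oriented D (L j))
    by (intros; eapply labelling_oriented; eauto).
  assert (V : forall j, (j < length H)%nat -> valid_arc (L j))
    by (intros; eapply oriented_valid; eauto).
  destruct (pick sod st H) as [[i e]|] eqn:PK.
  - apply pick_lt in PK as I. apply andb_true_iff in E as [E1 E2].
    destruct (oriented_blocked _ _ _ DP (L i) e (O i I)) as (b & Db & R).
    destruct LD as (C & NC & CD & LC & LH).
    assert (LD : labelling D L (length H)) by now exists C.
    destruct (in_dec arc_eq_dec b C) as [Cb|Cb].
    + apply (In_nth _ _ default_arc) in Cb as (j & J & Eb). rewrite LC in J.
      assert (R' : in_relint (L j) (tip (L i) e)).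
      { destruct (LH j J) as [-> | ->]; rewrite Eb; [exact R|now apply in_relint_rev]. }
      destruct (sign_of (side (L j) (L i) e)) as (s & S);
        [now apply (oriented_transversal _ _ _ DP); auto|].
      assert (HT : hits L i e j s) by now split.
      rewrite forallb_forall in E1. specialize (E1 (j, s)). cbn beta iota in E1.
      rewrite (side_ok_complete sod D P L H i e j s) in E1 by assumption.
      destruct (assume_hit tbl L H i e j s st _ T I J (V i I) (V j J) HT G M (E1 ltac:(
        apply in_prod; [apply in_seq; lia|destruct s; cbn; tauto]))) as (st' & M' & K).
      apply (IH (add_hit H i e j s) st' L); rewrite ?length_add_hit; auto.
      now apply graph_holds_add_hit.
    (* An unlabelled blocker leaves fewer than [n] labels in use, so the search did try a new
       one. *)
    + assert (N1 : (length (b :: C) <= length D)%nat).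
      { apply NoDup_incl_length; [now constructor|]. intros x [<-|X]; auto. }
      cbn in N1. destruct (Nat.leb_spec n (length H)) as [?|_]; [lia|]. cbn zeta in E2.
      set (m := length H) in *.
      destruct (sign_of (side b (L i) e)) as (s & Sb).
      { apply (oriented_transversal _ _ _ DP); auto. now left. }
      set (b' := if s then b else rev b).
      set (L' := fun k => if (k =? m)%nat then b' else L k).
      assert (A : agree m L L').
      { intros k Hk. unfold L'. destruct (Nat.eqb_spec k m); [lia|reflexivity]. }
      assert (Lm : L' m = b') by (unfold L'; now rewrite Nat.eqb_refl).
      assert (LD' : labelling D L' (S m)).
      { exists (C ++ [b]). split; [|split; [|split]].
        - apply NoDup_app; [exact NC|repeat constructor; intros []|].
          intros x X [<-|[]]. contradiction.
        - intros x X. apply in_app_or in X as [X|[<-|[]]]; auto.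
        - rewrite length_app. cbn. lia.
        - intros k Hk. destruct (Nat.eq_dec k m) as [->|Nk].
          + rewrite Lm, <- LC, nth_middle. unfold b'. destruct s; tauto.
          + rewrite <- (A k) by lia. rewrite app_nth1 by lia. apply LH. lia. }
      set (H' := H ++ [blank]) in *.
      assert (LH' : length H' = S m) by (unfold H'; rewrite length_app; cbn; lia).
      assert (G' : graph_holds L' H').
      { apply graph_holds_blank. now apply (graph_holds_agree L). }
      assert (HT : hits L' i e m true).
      { unfold hits. rewrite Lm, <- (A i I). unfold b'. destruct s; cbn [sg] in *.
        - now split.
        - rewrite side_rev_l. split; [now apply in_relint_rev|]. unfold sg in *. lra. }
      assert (V' : forall j, (j < S m)%nat -> valid_arc (L' j)).
      { intros j J. eapply oriented_valid; [exact DP|]. eapply labelling_oriented; eauto. }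
      destruct (assume_hit tbl L' H' i e m true st (search fuel tbl sod n (add_hit H' i e m true)) T)
        as (st' & M' & K); rewrite ?LH'; auto.
      { intros L'' A''. apply M. intros k Hk. rewrite (A k Hk). apply A''. lia. }
      apply (IH (add_hit H' i e m true) st' L'); rewrite ?length_add_hit, ?LH'; auto.
      * apply graph_holds_add_hit; rewrite ?LH'; auto.
      * now rewrite LH' in M'.
  - refine (no_poles_sound L tbl H P (seq 0 (length H)) [] [] st (T L) G V _ _ _ _ _ _ _ E).
    + eapply five_poles; eauto.
    + intros j J. eapply oriented_pole; eauto.
    + intros j J. apply in_seq in J. lia.
    + constructor.
    + constructor.
    + intros ? [].
    + apply M. now intros ? ?.
Qed.

Lemma search_blank_sound (sod : bool) (D : list arc) (P : list vec) (n : nat)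
    (tbl : PositiveMap.t (list relation)) (fuel : nat) :
  (forall L, table_holds L tbl) -> diagram sod D P -> D <> [] ->
  search fuel tbl sod n [blank] (PositiveMap.empty signs) = true -> (n < length D)%nat.
Proof.
  intros T DP N E. destruct (Nat.le_gt_cases (length D) n) as [DN|DN]; [exfalso|exact DN].
  destruct D as [|a D]; [contradiction|].
  apply (search_sound sod (a :: D) P n tbl fuel [blank] (PositiveMap.empty signs) (fun _ => a)); auto.
  - exists [a]. split; [repeat constructor; intros []|split; [|split; [reflexivity|]]].
    + intros x [<-|[]]; now left.
    + intros i Hi. left. now replace i with 0%nat by (cbn in Hi; lia).
  - intros i Hi. replace i with 0%nat by (cbn in Hi; lia).
    repeat split; try discriminate; contradiction.
  - intros L' _ k d. rewrite PositiveMap.gempty. discriminate.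
Qed.

Lemma refuted_sound (sod : bool) (D : list arc) (P : list vec) (n : nat) :
  refuted sod n = true -> diagram sod D P -> D <> [] -> (n < length D)%nat.
Proof.
  unfold refuted. intros E DP N.
  exact (search_blank_sound sod D P n table 20 table_sound DP N E).
Qed.

(** * Spherical diagrams *)

Lemma oriented_ind (D : list arc) (Q : arc -> Prop) :
  (forall a, In a D -> Q a) -> (forall a, Q a -> Q (rev a)) -> forall a, oriented D a -> Q a.
Proof. intros H R a [I|I]; [now apply H|]. rewrite <- (rev_rev a). now apply R, H. Qed.

Lemma tip_not_in_relint (a : arc) (e : bool) : valid_arc a -> ~ in_relint a (tip a e).
Proof.
  intros V R. destruct e; cbn in R.
  - apply (relint_before_aq a _ V) in R.
    replace (vdot _ _) with 0 in R by (unfold normal; vec_ring). lra.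
  - apply (relint_after_ap a _ V) in R.
    replace (vdot _ _) with 0 in R by (unfold normal; vec_ring). lra.
Qed.

(** Take [d = min(s,t) / (1 + |u| + |v|)], so that [d|u|] and [d|v|] both stay below [min(s,t)]. *)
Lemma small_step (s t u v : R) : 0 < s -> 0 < t -> exists d, 0 < d /\ 0 < s + d * u /\ 0 < t + d * v.
Proof.
  intros Hs Ht. pose proof (Rabs_pos u). pose proof (Rabs_pos v).
  pose proof (Rle_abs (- u)) as U. pose proof (Rle_abs (- v)) as W. rewrite Rabs_Ropp in U, W.
  set (k := 1 + Rabs u + Rabs v). set (m := Rmin s t).
  assert (M : 0 < m) by now apply Rmin_pos.
  pose proof (Rmin_l s t : m <= s). pose proof (Rmin_r s t : m <= t).
  assert (K : 0 < k) by (unfold k; lra).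
  assert (D : 0 < m / k) by now apply Rdiv_lt_0_compat.
  assert (E : m / k * k = m) by (field; lra).
  exists (m / k). unfold k in *. split; [exact D|]. split; nra.
Qed.

Lemma relint_normalize (a : arc) (s t : R) :
  0 < s -> 0 < t -> let z := vadd (vscale s (ap a)) (vscale t (aq a)) in
  0 < vdot z z -> in_relint a (vscale (/ sqrt (vdot z z)) z).
Proof.
  intros Hs Ht z Z. set (r := / sqrt (vdot z z)).
  assert (Hr : 0 < r) by (apply Rinv_0_lt_compat, sqrt_lt_R0, Z).
  split.
  - unfold on_sphere. transitivity (r * r * vdot z z); [vec_ring|].
    rewrite <- (sqrt_sqrt (vdot z z)) by lra. unfold r. field.
    apply Rgt_not_eq, sqrt_lt_R0, Z.
  - exists (r * s), (r * t). split; [|split]; try now apply Rmult_lt_0_compat.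
    unfold z. vec_eq_ring.
Qed.

(* Two arcs of one great circle that touch in this way would overlap just beyond the hit. *)
Lemma hit_transversal (a b : arc) (e : bool) :
  valid_arc a -> valid_arc b -> (forall x, ~ (in_relint a x /\ in_relint b x)) ->
  in_relint b (tip a e) -> side b a e <> 0.
Proof.
  intros Va Vb Disj [_ (s & t & Hs & Ht & E)] Z.
  destruct (plane_coordinates b _ Vb Z) as (u & v & E').
  destruct (small_step s t u v Hs Ht) as (d & Hd & Su & Sv).
  (* A point just off the hit towards the other end of [a]; after normalisation it lies in both
     relative interiors. *)
  set (z := vadd (tip a e) (vscale d (tip a (negb e)))).
  assert (Zb : z = vadd (vscale (s + d * u) (ap b)) (vscale (t + d * v) (aq b)))
    by (unfold z; rewrite E, E'; vec_eq_ring).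
  assert (Zp : 0 < vdot z z).
  { destruct (vdot_self_nonneg z) as [H|H]; [exact H|exfalso].
    symmetry in H. apply vdot_self_eq0 in H.
    assert (N : vdot (normal b) (vcross (ap b) z) = (t + d * v) * vdot (normal b) (normal b))
      by (rewrite Zb; unfold normal; vec_ring).
    rewrite H in N. replace (vdot (normal b) (vcross (ap b) vzero)) with 0 in N by vec_ring.
    pose proof (Rmult_lt_0_compat _ _ Sv (normal_pos b Vb)). lra. }
  apply (Disj (vscale (/ sqrt (vdot z z)) z)). split.
  - destruct e; cbn in z.
    + assert (Za : z = vadd (vscale d (ap a)) (vscale 1 (aq a))) by (unfold z; vec_eq_ring).
      rewrite Za in *. apply relint_normalize; trivial; lra.
    + assert (Za : z = vadd (vscale 1 (ap a)) (vscale d (aq a))) by (unfold z; vec_eq_ring).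
      rewrite Za in *. apply relint_normalize; trivial; lra.
  - rewrite Zb in *. now apply relint_normalize.
Qed.

Lemma spherical_diagram_diagram (sod : bool) (D : list arc) :
  spherical_diagram D -> (sod = true -> spherical_occlusion_diagram D) -> k_oriented 5 D ->
  exists P, diagram sod D P.
Proof.
  intros (NE & V & Disj & Bl) Occ (P & P5 & PS & _ & f & Pf).
  rewrite Forall_forall in V, PS.
  exists P. constructor.
  - apply oriented_ind; [exact V|apply valid_arc_rev].
  - intros a e A. revert e. pattern a. revert a A. apply oriented_ind.
    + intros a A. destruct (Bl a A) as [B1 B2]. now intros [|].
    + intros a A e. rewrite tip_rev. apply A.
  - intros a b e A B. revert e. pattern a. revert a A. apply oriented_ind.
    + intros a A e. pattern b. revert b B. apply oriented_ind.
      (* The indices differ because an arc never contains its own endpoint in its relative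
         interior. *)
      * intros b B R. apply (In_nth _ _ default_arc) in A as IA, B as IB.
        destruct IA as (i & Hi & Ei), IB as (j & Hj & Ej).
        apply hit_transversal; auto. intros x. rewrite <- Ei, <- Ej. apply Disj; trivial.
        intros <-. rewrite Ei in Ej. subst b. now apply (tip_not_in_relint a e (V a A)).
      * intros b B R. rewrite side_rev_l. apply in_relint_rev in R. rewrite rev_rev in R.
        specialize (B R). lra.
    + intros a A e. rewrite tip_rev, side_rev_r. apply A.
  - intros T. destruct (Occ T) as [_ O].
    assert (O' : forall a b c e e', In a D -> In b D -> In c D ->
      in_relint a (tip b e) -> in_relint a (tip c e') -> 0 < side a b e * side a c e').
    { intros a b c e e' A B C Rb Rc.
      apply (O a b c (tip b e) (tip b (negb e)) (tip c e') (tip c (negb e'))); trivial;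
        [destruct e|destruct e']; cbn; unfold endpoint_pair; auto. }
    intros a b c e e' A B C. revert e e'. pattern a. revert a A. apply oriented_ind.
    + intros a A. pattern b. revert b B. apply oriented_ind.
      * intros b B. pattern c. revert c C. apply oriented_ind.
        -- intros c C e e'. now apply O'.
        -- intros c C e e'. rewrite (tip_rev c), (side_rev_r a c). apply C.
      * intros b B e e'. rewrite (tip_rev b), (side_rev_r a b). apply B.
    + intros a A e e' Rb Rc. apply in_relint_rev in Rb, Rc. rewrite rev_rev in Rb, Rc.
      rewrite !side_rev_l. specialize (A e e' Rb Rc). lra.
  - apply oriented_ind.
    + intros a A. apply (In_nth _ _ default_arc) in A as (i & Hi & <-).
      destruct (Pf i Hi) as (F & Z & N1 & N2).
      assert (I : In (nth (f i) P vzero) P) by (apply nth_In; lia).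
      exists (nth (f i) P vzero). split; [exact I|]. repeat split; auto.
    + intros a (c & I & H). exists c. split; [exact I|now apply pole_rev].
  - exact P5.
Qed.

(** * The two computations *)

(** [vm_cast_no_check] leaves the evaluation to the kernel, so the search runs only once, at
    [Qed]. *)
Lemma refuted_7 : refuted false 7 = true.
Proof. vm_cast_no_check (eq_refl true). Qed.

Lemma refuted_8_one_sided : refuted true 8 = true.
Proof. vm_cast_no_check (eq_refl true). Qed.

Theorem mainTheorem6 :
  (forall D : list arc, spherical_diagram D -> k_oriented 5 D -> (8 <= length D)%nat) /\
  (forall D : list arc, spherical_occlusion_diagram D -> k_oriented 5 D -> (9 <= length D)%nat).
Proof.
  split; intros D S K.
  - destruct (spherical_diagram_diagram false D S) as [P DP]; [discriminate|exact K|].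
    exact (refuted_sound _ _ _ _ refuted_7 DP (proj1 S)).
  - destruct (spherical_diagram_diagram true D (proj1 S)) as [P DP]; [now intros _|exact K|].
    exact (refuted_sound _ _ _ _ refuted_8_one_sided DP (proj1 (proj1 S))).
Qed.
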